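(* Let $\mathbb{X}$ be a reflexive, smooth and strictly convex complex Banach space with $\dim(\mathbb{X})>2$. Then the following are equivalent. (1) $\mathbb{X}$ is a Hilbert space. (2) $T_*$ is a linear map for every rank one linear map $T\in\mathcal{B}(\mathbb{X})$. (3) $(I+U)_*=I+U_*$, where $U$ is the bilateral shift operator on $\ell_2(\mathbb{Z},\mathbb{X})$ defined by $U((x_n)_{n\in\mathbb{Z}})=(x_{n-1})_{n\in\mathbb{Z}}$.
   Context: A Banach space ''is a Hilbert space'' if its norm is induced by an inner product. A Banach space $\mathbb{E}$ is smooth if each nonzero $x\in\mathbb{E}$ has a unique support functional $f_x\in\mathbb{E}^*$, i.e. $\|f_x\|=\|x\|$, $f_x(x)=\|x\|^2$ (and $f_{\mathbf 0}=\mathbf 0$). For $\mathbb{E}$ reflexive, smooth and strictly convex, the duality map $\mathbb{J}_{\mathbb{E}}:\mathbb{E}\to\mathbb{E}^*$, $x\mapsto f_x$, is a (not necessarily linear) norm-preserving bijection. For $T\in\mathcal{B}(\mathbb{E})$ with Banach adjoint $T^\times f=f\circ T$, the adjoint $T_*:\mathbb{E}\to\mathbb{E}$ is the map $T_*(x)=\mathbb{J}_{\mathbb{E}}^{-1}T^\times\mathbb{J}_{\mathbb{E}}(x)$ (not linear in general). $\ell_2(\mathbb{Z},\mathbb{X})$ is the Banach space of bi-sequences $(x_n)_{n\in\mathbb{Z}}$ in $\mathbb{X}$ with $\sum_n\|x_n\|^2<\infty$ and norm $(\sum_n\|x_n\|^2)^{1/2}$; it is again reflexive, smooth and strictly convex,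 and in (3) the adjoints are taken on this space. *)

(* Defs.v *)
From HB Require Import structures.
From mathcomp Require Import all_boot all_order all_algebra.
From mathcomp Require Import ring lra.
From mathcomp Require Import complex.
From mathcomp Require Import all_classical all_reals all_analysis.

Set Implicit Arguments.
Unset Strict Implicit.
Unset Printing Implicit Defensive.

Import Order.TTheory GRing.Theory Num.Theory.
Import numFieldNormedType.Exports.

Local Open Scope classical_set_scope.
Local Open Scope ring_scope.
Local Open Scope complex_scope.

(* The norm of a normed module over [R[i]] takes its values in [R[i]] (in the
   nonnegative reals of [R[i]]); [nrm] is the same norm, valued in [R]. *)
Section real_valued_norm.
Context {R : realType} {E : normedModType R[i]}.
Implicit Types x y : E.

Definition nrm x : R := complex.Re `|x|.

Lemma nrmE x : (nrm x)%:C = `|x|.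
Proof.
have := ger0_Im (normr_ge0 x); rewrite /nrm.
by case: `|x| => a b /= ->.
Qed.

Lemma Re_normE (a : R[i]) : (complex.Re `|a|)%:C = `|a|.
Proof. by have := ger0_Im (normr_ge0 a); case: `|a| => b c /= ->. Qed.

Lemma nrm_ge0 x : 0 <= nrm x.
Proof. by rewrite -ler0c nrmE. Qed.

Lemma nrm_eq0 x : nrm x = 0 -> x = 0.
Proof. by move=> x0; apply/normr0_eq0; rewrite -nrmE x0. Qed.

Lemma nrm0 : nrm (0 : E) = 0.
Proof. by rewrite /nrm normr0. Qed.

Lemma nrmD x y : nrm (x + y) <= nrm x + nrm y.
Proof. by rewrite -lecR rmorphD/= !nrmE ler_normD. Qed.

Lemma nrmZ (a : R[i]) x : nrm (a *: x) = complex.Re `|a| * nrm x.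
Proof.
by rewrite /nrm normrZ; move: (ger0_Im (normr_ge0 a)) (ger0_Im (normr_ge0 x));
  case: `|a| `|x| => [b c] [b' c'] /= -> ->; rewrite mulr0 subr0.
Qed.

End real_valued_norm.

Section bounded_operators.
Context {R : realType}.

Definition bounded_op_pred (E F : normedModType R[i]) : {pred E -> F} :=
  fun f => `[< linear f /\ continuous f >].

Record bounded_op (E F : normedModType R[i]) := BoundedOp {
  bounded_op_fun :> E -> F ;
  bounded_op_subproof : bounded_op_fun \in @bounded_op_pred E F }.

Section lmodule.
Variables E F : normedModType R[i].

HB.instance Definition _ := [isSub for @bounded_op_fun E F].
HB.instance Definition _ := [Choice of bounded_op E F by <:].

Lemma bounded_op_linear (f : bounded_op E F) : linear f.
Proof. by case: f => f /= /asboolP[]. Qed.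

Lemma bounded_op_continuous (f : bounded_op E F) : continuous f.
Proof. by case: f => f /= /asboolP[]. Qed.

HB.instance Definition _ (f : bounded_op E F) :=
  GRing.isLinear.Build R[i] E F *:%R f (bounded_op_linear f).

Lemma bounded_op_submod_closed : submod_closed (@bounded_op_pred E F).
Proof.
split.
  apply/asboolP; split; last exact: cst_continuous.
  by move=> a u v; rewrite /= scaler0 addr0.
move=> a f g /asboolP[lf cf] /asboolP[lg cg]; apply/asboolP; split.
  move=> b u v; rewrite !fctE lf lg !scalerDr !scalerA (mulrC a b).
  by rewrite addrACA.
by move=> x; apply: cvgD; [apply: cvgZr; exact: cf|exact: cg].
Qed.

HB.instance Definition _ :=
  GRing.isSubmodClosed.Build R[i] (E -> F) (@bounded_op_pred E F)
    bounded_op_submod_closed.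
HB.instance Definition _ := [SubChoice_isSubLmodule of bounded_op E F by <:].

Lemma bounded_opE f (Pf : f \in @bounded_op_pred E F) x : BoundedOp Pf x = f x.
Proof. by []. Qed.

Lemma bounded_op_ext (f g : bounded_op E F) : f =1 g -> f = g.
Proof. by move=> fg; apply/val_inj/funext. Qed.

Lemma bounded_op_bound (f : bounded_op E F) :
  exists2 k : R, 0 < k & forall x, nrm (f x) <= k * nrm x.
Proof.
have /linear_boundedP/pinfty_ex_gt0[r r0 fr] :=
  continuous_linear_bounded 0 (@bounded_op_continuous f (0 : E)).
have rE : (complex.Re r)%:C = r by case: r r0 {fr} => a b; rewrite ltcE/= => /andP[/eqP->].
exists (complex.Re r); first by rewrite -ltcR rE.
move=> x; rewrite -lecR rmorphM/= rE !nrmE; exact: fr.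
Qed.

Definition opnorm (f : bounded_op E F) : R :=
  sup [set nrm (f x) | x in [set x | nrm x <= 1]].

Lemma opnorm_has_sup (f : bounded_op E F) :
  has_sup [set nrm (f x) | x in [set x | nrm x <= 1]].
Proof.
split; first by exists (nrm (f 0)), 0; rewrite //= nrm0 ler01.
have [k k0 fk] := bounded_op_bound f; exists k => _ [x /= x1 <-].
by rewrite (le_trans (fk x))// -[leRHS]mulr1 ler_pM2l.
Qed.

Lemma opnorm_ub (f : bounded_op E F) x : nrm x <= 1 -> nrm (f x) <= opnorm f.
Proof.
by move=> x1; apply: ub_le_sup; [have [] := opnorm_has_sup f|exists x].
Qed.

Lemma opnorm_le (f : bounded_op E F) (k : R) :
  (forall x, nrm x <= 1 -> nrm (f x) <= k) -> opnorm f <= k.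
Proof.
move=> fk; apply: ge_sup; first by have [] := opnorm_has_sup f.
by move=> _ [x x1 <-]; exact: fk.
Qed.

Lemma nrm_bounded_op (f : bounded_op E F) x : nrm (f x) <= opnorm f * nrm x.
Proof.
have [->|x0] := eqVneq x 0; first by rewrite linear0 !nrm0 mulr0.
have nx0 : 0 < nrm x.
  by rewrite lt_neqAle nrm_ge0 andbT eq_sym; apply: contra_neq x0 => /nrm_eq0.
rewrite -ler_pdivrMr//.
have e : complex.Re `|((nrm x)^-1)%:C| = (nrm x)^-1.
  by rewrite ger0_norm// ler0c invr_ge0 ltW.
have := @opnorm_ub f (((nrm x)^-1)%:C *: x).
rewrite linearZ !nrmZ e mulVf ?gt_eqF// => /(_ (lexx _)).
by rewrite mulrC.
Qed.

Let opnormD (f g : bounded_op E F) :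
  (opnorm (f + g))%:C <= (opnorm f)%:C + (opnorm g)%:C.
Proof.
rewrite -rmorphD/= lecR; apply: opnorm_le => x x1.
by rewrite (le_trans (nrmD _ _))// lerD// opnorm_ub.
Qed.

Let opnormZ (a : R[i]) (f : bounded_op E F) :
  (opnorm (a *: f))%:C = `|a| * (opnorm f)%:C.
Proof.
suff e : opnorm (a *: f) = complex.Re `|a| * opnorm f.
  by rewrite e rmorphM/= Re_normE.
have le b (g : bounded_op E F) : opnorm (b *: g) <= complex.Re `|b| * opnorm g.
  apply: opnorm_le => x x1; rewrite [X in nrm X](_ : _ = b *: g x)// nrmZ.
  by apply: ler_wpM2l; [rewrite -lecR Re_normE normr_ge0|exact: opnorm_ub].
apply/eqP; rewrite eq_le le andTb; have [->|a0] := eqVneq a 0.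
  rewrite normr0 mul0r.
  by rewrite (le_trans (nrm_ge0 ((0 *: f : bounded_op E F) 0)))// opnorm_ub ?nrm0.
have na0 : 0 < complex.Re `|a|.
  by rewrite -ltcR Re_normE normr_gt0.
rewrite mulrC -ler_pdivlMr//; have := le a^-1 (a *: f).
rewrite scalerA mulVf// scale1r normfV mulrC.
suff -> : complex.Re `|a|^-1 = (complex.Re `|a|)^-1 by [].
by rewrite -[`|a| in LHS]Re_normE -fmorphV.
Qed.

Let opnorm_eq0 (f : bounded_op E F) : (opnorm f)%:C = 0 -> f = 0.
Proof.
move=> /complexI f0; apply: bounded_op_ext => x; apply: nrm_eq0.
apply/eqP; rewrite eq_le nrm_ge0 andbT.
by rewrite (le_trans (nrm_bounded_op f x))// f0 mul0r.
Qed.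

HB.instance Definition _ := @Lmodule_isNormed.Build R[i] (bounded_op E F)
  (fun f => (opnorm f)%:C) opnormD opnormZ opnorm_eq0.

End lmodule.

Lemma id_op_subproof (E : normedModType R[i]) : idfun \in @bounded_op_pred E E.
Proof. by apply/asboolP; split => // x. Qed.

Definition id_op (E : normedModType R[i]) : bounded_op E E :=
  BoundedOp (id_op_subproof E).

Lemma comp_op_subproof (E F G : normedModType R[i])
    (g : bounded_op F G) (f : bounded_op E F) : g \o f \in @bounded_op_pred E G.
Proof.
apply/asboolP; split; first by move=> a u v /=; rewrite !linearP.
by move=> x; apply: continuous_comp; exact: bounded_op_continuous.
Qed.

Definition comp_op (E F G : normedModType R[i])
    (g : bounded_op F G) (f : bounded_op E F) : bounded_op E G :=
  BoundedOp (comp_op_subproof g f).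

End bounded_operators.

Section banach_spaces.
Context {R : realType}.

Definition dual (E : normedModType R[i]) := bounded_op E R[i]^o.

Definition banach_adjoint (E F : normedModType R[i]) (T : bounded_op E F)
  (f : dual F) : dual E := comp_op f T.

(* Surjectivity of the canonical embedding of [E] into its bidual. *)
Definition reflexive_space (E : normedModType R[i]) : Prop :=
  forall phi : dual (dual E), exists x : E, forall f : dual E, phi f = f x.

Definition support_functional (E : normedModType R[i]) (x : E) (f : dual E) :=
  `|f| = `|x| /\ f x = `|x| ^+ 2.

Definition smooth_space (E : normedModType R[i]) : Prop :=
  forall x : E, x != 0 -> exists! f : dual E, support_functional x f.

Definition strictly_convex_space (E : normedModType R[i]) : Prop :=
  forall x y : E, `|x| = 1 -> `|y| = 1 -> x != y -> `|x + y| < 2.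

Definition is_hilbert (E : normedModType R[i]) : Prop :=
  exists ip : {dot E for @Num.conj R[i]}, forall x : E, `|x| ^+ 2 = ip x x.

(* [E] may be infinite-dimensional, so [\dim] is not available. *)
Definition dim_gt2 (E : normedModType R[i]) : Prop :=
  exists v : 'I_3 -> E, forall c : 'I_3 -> R[i],
    \sum_(i < 3) c i *: v i = 0 -> forall i, c i = 0.

Section adjoint.
Variable E : normedModType R[i].

(* If [E] is smooth, [duality_map x] is the support functional of [x]: it is
   the unique one when [x != 0], and [support_functional 0 f] forces [f = 0]. *)
Definition duality_map (x : E) : dual E :=
  xget (0 : dual E) [set f | support_functional x f].

Lemma duality_mapP (x : E) :
  smooth_space E -> support_functional x (duality_map x).
Proof.
move=> smE; apply: xgetPex; have [->|/smE[f [fx _]]] := eqVneq x 0.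
  by exists 0; split; rewrite ?normr0// expr0n.
by exists f.
Qed.

(* The inverse of [duality_map], which is a bijection if [E] is reflexive,
   smooth and strictly convex. *)
Definition duality_map_inv (f : dual E) : E :=
  xget 0 [set x | duality_map x = f].

Definition adjoint (T : bounded_op E E) (x : E) : E :=
  duality_map_inv (banach_adjoint T (duality_map x)).

Definition rank_one (T : bounded_op E E) : Prop :=
  exists2 v : E, v != 0 & range T = [set c *: v | c in [set: R[i]]].

End adjoint.
End banach_spaces.

Section l2Z.
Context {R : realType}.

Section l2_space.
Variable X : normedModType R[i].
Implicit Types u v : int -> X.

Definition sqr_sum u : \bar R := \esum_(n in [set: int]) (nrm (u n) ^+ 2)%:E.

Definition l2Z_pred : {pred int -> X} := fun u => `[< (sqr_sum u < +oo)%E >].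

Record l2Z := L2Z {
  l2Z_fun :> int -> X ;
  l2Z_subproof : l2Z_fun \in l2Z_pred }.

HB.instance Definition _ := [isSub for l2Z_fun].
HB.instance Definition _ := [Choice of l2Z by <:].

Definition l2norm u : R := Num.sqrt (fine (sqr_sum u)).

Lemma sqr_sum_ge0 u : (0 <= sqr_sum u)%E.
Proof. by apply: esum_ge0 => n _; rewrite lee_fin sqr_ge0. Qed.

Lemma l2Z_predE u : (u \in l2Z_pred) = (sqr_sum u < +oo)%E.
Proof. by apply/asboolP/idP. Qed.

Lemma sqr_sumE u : u \in l2Z_pred -> sqr_sum u = (l2norm u ^+ 2)%:E.
Proof.
rewrite l2Z_predE => uoo; have u0 := sqr_sum_ge0 u.
by rewrite sqr_sqrtr ?fine_ge0// fineK// ge0_fin_numE.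
Qed.

Lemma l2norm_ge0 u : 0 <= l2norm u.
Proof. exact: sqrtr_ge0. Qed.

Lemma sqr_sum_le u (k : R) : 0 <= k -> (sqr_sum u <= (k ^+ 2)%:E)%E ->
  u \in l2Z_pred /\ l2norm u <= k.
Proof.
move=> k0 uk; have ul : u \in l2Z_pred.
  by rewrite l2Z_predE (le_lt_trans uk)// ltry.
by split => //; move: uk; rewrite sqr_sumE// lee_fin ler_sqr// nnegrE l2norm_ge0.
Qed.

Let esumZ_le u (e : R) : 0 <= e ->
  (\esum_(n in [set: int]) (e * nrm (u n) ^+ 2)%:E <= e%:E * sqr_sum u)%E.
Proof.
move=> e0; apply: ge_ereal_sup => _ [A [finA AT]] <-.
have -> : (\sum_(n \in A) (e * nrm (u n) ^+ 2)%:E =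
    e%:E * \sum_(n \in A) (nrm (u n) ^+ 2)%:E)%E.
  by rewrite ge0_mule_fsumr// => n; rewrite lee_fin sqr_ge0.
by rewrite lee_wpmul2l ?lee_fin// ereal_sup_ubound//; exists A.
Qed.

Lemma sqr_sumD_le u v (a b : R) : 0 < a -> 0 < b ->
  (sqr_sum u <= (a ^+ 2)%:E)%E -> (sqr_sum v <= (b ^+ 2)%:E)%E ->
  (sqr_sum (u + v)%R <= ((a + b) ^+ 2)%:E)%E.
Proof.
move=> a0 b0 ua vb; pose c := 1 + b / a; pose d := 1 + a / b.
have c0 : 0 <= c by rewrite addr_ge0// divr_ge0// ltW.
have d0 : 0 <= d by rewrite addr_ge0// divr_ge0// ltW.
apply: (@le_trans _ _ (c%:E * sqr_sum u + d%:E * sqr_sum v)%E).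
  apply: le_trans (leeD (esumZ_le u c0) (esumZ_le v d0)).
  rewrite -esumD; last 2 first.
  - by move=> n _; rewrite lee_fin mulr_ge0// sqr_ge0.
  - by move=> n _; rewrite lee_fin mulr_ge0// sqr_ge0.
  apply: le_esum => n _; rewrite -EFinD lee_fin.
  apply: (@le_trans _ _ ((nrm (u n) + nrm (v n)) ^+ 2)).
    by rewrite ler_sqr ?nnegrE ?addr_ge0 ?nrm_ge0// nrmD.
  set x := nrm (u n); set y := nrm (v n); rewrite -subr_ge0.
  have -> : c * x ^+ 2 + d * y ^+ 2 - (x + y) ^+ 2 = (b * x - a * y) ^+ 2 / (a * b).
    by rewrite /c /d; field; rewrite !gt_eqF.
  by rewrite divr_ge0 ?sqr_ge0// mulr_ge0// ltW.
apply: (@le_trans _ _ (c%:E * (a ^+ 2)%:E + d%:E * (b ^+ 2)%:E)%E).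
  by rewrite leeD// lee_wpmul2l// lee_fin.
rewrite -!EFinM -EFinD lee_fin.
suff -> : c * a ^+ 2 + d * b ^+ 2 = (a + b) ^+ 2 by [].
by rewrite /c /d; field; rewrite !gt_eqF.
Qed.

Lemma l2Z_predD u v : u \in l2Z_pred -> v \in l2Z_pred ->
  u + v \in l2Z_pred /\ l2norm (u + v) <= l2norm u + l2norm v.
Proof.
move=> lu lv.
have H e : 0 < e ->
    u + v \in l2Z_pred /\ l2norm (u + v) <= (l2norm u + e) + (l2norm v + e).
  move=> e0; apply: sqr_sum_le.
    by rewrite !addr_ge0 ?l2norm_ge0// ltW.
  have le w : w \in l2Z_pred -> (sqr_sum w <= ((l2norm w + e) ^+ 2)%:E)%E.
    move=> lw; rewrite sqr_sumE// lee_fin ler_sqr ?nnegrE ?addr_ge0 ?l2norm_ge0//.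
    - by rewrite lerDl ltW.
    - exact: ltW.
  by apply: sqr_sumD_le; rewrite ?ltr_wpDl ?l2norm_ge0//; exact: le.
split; first by have [] := H 1 ltr01.
apply/ler_addgt0Pr => e e0; have [|_] := H (e / 2); first by rewrite divr_gt0.
by rewrite addrACA -splitr.
Qed.

Lemma l2Z_predZ (a : R[i]) u : u \in l2Z_pred ->
  a *: u \in l2Z_pred /\ l2norm (a *: u) <= complex.Re `|a| * l2norm u.
Proof.
move=> lu; have a0 : 0 <= complex.Re `|a| by rewrite -lecR Re_normE normr_ge0.
apply: sqr_sum_le; first by rewrite mulr_ge0 ?l2norm_ge0.
rewrite exprMn EFinM -sqr_sumE//; apply: le_trans (esumZ_le u (sqr_ge0 _)).
by apply: le_esum => n _; rewrite [X in nrm X](_ : _ = a *: u n)// nrmZ exprMn.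
Qed.

Lemma l2Z_pred0 : 0 \in l2Z_pred.
Proof.
by apply: (@proj1 _ _ (sqr_sum_le (lexx 0) _)); rewrite /sqr_sum esum1// => n _;
  rewrite nrm0 expr0n.
Qed.

Lemma l2Z_submod_closed : submod_closed l2Z_pred.
Proof.
split; first exact: l2Z_pred0.
move=> a u v lu lv; have [lau _] := l2Z_predZ a lu.
by have [] := l2Z_predD lau lv.
Qed.

HB.instance Definition _ :=
  GRing.isSubmodClosed.Build R[i] (int -> X) l2Z_pred l2Z_submod_closed.
HB.instance Definition _ := [SubChoice_isSubLmodule of l2Z by <:].

Lemma l2Z_ext (u v : l2Z) : u =1 v -> u = v.
Proof. by move=> uv; apply/val_inj/funext. Qed.

Lemma nrm_le_l2norm u n : u \in l2Z_pred -> nrm (u n) <= l2norm u.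
Proof.
move=> lu; rewrite -ler_sqr ?nnegrE ?nrm_ge0 ?l2norm_ge0// -lee_fin -sqr_sumE//.
apply: esum_ge; exists [set n]; first by split; [exact: finite_set1|].
by rewrite fsbig_set1.
Qed.

Let l2normD (u v : l2Z) : (l2norm (u + v))%:C <= (l2norm u)%:C + (l2norm v)%:C.
Proof.
rewrite -rmorphD/= lecR.
by have [] := l2Z_predD (l2Z_subproof u) (l2Z_subproof v).
Qed.

Let l2normZ (a : R[i]) (u : l2Z) :
  (l2norm (a *: u))%:C = `|a| * (l2norm u)%:C.
Proof.
suff e : l2norm (a *: u) = complex.Re `|a| * l2norm u.
  by rewrite e rmorphM/= Re_normE.
have le b (v : l2Z) : l2norm (b *: v) <= complex.Re `|b| * l2norm v.
  by have [] := l2Z_predZ b (l2Z_subproof v).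
apply/eqP; rewrite eq_le le andTb; have [->|a0] := eqVneq a 0.
  by rewrite normr0 mul0r l2norm_ge0.
have na0 : 0 < complex.Re `|a|.
  by rewrite -ltcR Re_normE normr_gt0.
rewrite mulrC -ler_pdivlMr//; have := le a^-1 (a *: u).
rewrite scalerA mulVf// scale1r normfV mulrC.
suff -> : complex.Re `|a|^-1 = (complex.Re `|a|)^-1 by [].
by rewrite -[`|a| in LHS]Re_normE -fmorphV.
Qed.

Let l2norm_eq0 (u : l2Z) : (l2norm u)%:C = 0 -> u = 0.
Proof.
move=> /complexI u0; apply: l2Z_ext => n; apply: nrm_eq0.
by apply/eqP; rewrite eq_le nrm_ge0 andbT -u0 nrm_le_l2norm// l2Z_subproof.
Qed.

HB.instance Definition _ := @Lmodule_isNormed.Build R[i] l2Z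
  (fun u : l2Z => (l2norm u)%:C) l2normD l2normZ l2norm_eq0.

Lemma nrm_l2ZE (u : l2Z) : nrm u = l2norm u.
Proof. by []. Qed.

End l2_space.

Section l2Z_complete.
Variable X : completeNormedModType R[i].

Let l2Z_complete (F : set_system (l2Z X)) : ProperFilter F -> cauchy F -> cvg F.
Proof.
move=> FF /cauchyP Fc.
have Fn n : cvg ((fun u : l2Z X => u n) @ F).
  apply: cauchy_cvg; apply: cauchy_exP => e e0.
  have [w Fw] := Fc _ e0; exists (w n); rewrite /= /nbhs/=.
  apply: filterS Fw => u; rewrite -!ball_normE/=; apply: le_lt_trans.
  by rewrite -!nrmE lecR (nrm_le_l2norm n (l2Z_subproof (w - u))).
pose x n := lim ((fun u : l2Z X => u n) @ F).
have Fx n : (fun u : l2Z X => u n) @ F --> x n by exact: Fn.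
have key (e : R) (w : l2Z X) : 0 < e -> F (ball w e%:C) ->
    (sqr_sum (fun n => w n - x n)%R <= (e ^+ 2)%:E)%E.
  move=> e0 Fw; apply: ge_ereal_sup => _ [A [finA _]] <-.
  rewrite fsbig_finite//= sumEFin lee_fin.
  pose f (u : l2Z X) := \sum_(n <- finmap.enum_fset (fset_set A)) nrm (w n - u n) ^+ 2.
  have fx : f @ F --> \sum_(n <- finmap.enum_fset (fset_set A)) nrm (w n - x n) ^+ 2.
    rewrite /f; elim: (finmap.enum_fset _) => [|n s IHs].
      by under eq_fun do rewrite big_nil; rewrite big_nil; exact: cvg_cst.
    under eq_fun do rewrite big_cons; rewrite big_cons; apply: cvgD => //.
    have nx : (fun u : l2Z X => nrm (w n - u n)) @ F --> nrm (w n - x n).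
      apply/cvgrPdist_lt => d d0; have dC : 0 < d%:C by rewrite -[0]/(0%:C) ltcR.
      have : \forall u \near F, `|x n - (u : l2Z X) n| < d%:C by exact: cvgr_dist_lt (Fx n) _ dC.
      apply: filterS => u.
      rewrite -nrmE ltcR => xu; apply: le_lt_trans xu.
      have le (a b c : X) : nrm (a - b) - nrm (a - c) <= nrm (b - c).
        rewrite lerBlDr -{1}(subrK c a) -addrA (le_trans (nrmD _ _))//.
        by rewrite [leRHS]addrC lerD2l /nrm distrC.
      by rewrite ler_norml lerNl opprB le andbT (le_trans (le _ _ _))// /nrm distrC.
    by rewrite expr2; under eq_fun do rewrite expr2; exact: cvgM.
  apply: (cvgr_to_le fx); apply: filterS Fw => u.
  rewrite -ball_normE /= -nrmE ltcR => /ltW wu.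
  rewrite -lee_fin -sumEFin.
  have := sqr_sumE (l2Z_subproof (w - u)); rewrite -nrm_l2ZE => wuE.
  apply: (@le_trans _ _ (nrm (w - u) ^+ 2)%:E); last first.
    by rewrite lee_fin ler_sqr// nnegrE ?nrm_ge0// ltW.
  rewrite -wuE; apply: ereal_sup_ubound; exists A => //.
  by rewrite fsbig_finite.
have xl : x \in @l2Z_pred X.
  have [w Fw] := Fc 1 ltr01.
  have [] := sqr_sum_le ler01 (key 1 w ltr01 Fw) => wx _.
  have -> : x = (w : int -> X) - (fun n => w n - x n).
    by apply/funext => n; rewrite !fctE opprB addrC subrK.
  exact: rpredB (l2Z_subproof w) wx.
apply/cvg_ex; exists (L2Z xl); apply/fcvgrPdist_lt => e e0.
have eE : e = (complex.Re e)%:C by rewrite -[in LHS](gtr0_norm e0) -Re_normE gtr0_norm.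
have r0 : 0 < complex.Re e by rewrite -ltcR -eE.
have h0 : 0 < complex.Re e / 2 by rewrite divr_gt0.
have hC : 0 < (complex.Re e / 2)%:C by rewrite -[0]/(0%:C) ltcR.
have [w Fw] := Fc _ hC; apply: filterS (Fw) => u.
have [_ wx] := sqr_sum_le (ltW h0) (key _ w h0 Fw).
rewrite -ball_normE /= => wu.
have {}wu : nrm (w - u) < complex.Re e / 2 by rewrite -ltcR nrmE.
rewrite eE -nrmE ltcR.
have -> : L2Z xl - u = - (w - L2Z xl) + (w - u).
  by rewrite opprB addrA subrK.
rewrite (le_lt_trans (nrmD _ _))// [ltRHS]splitr ler_ltD//.
by rewrite /nrm normrN.
Qed.

HB.instance Definition _ := Uniform_isComplete.Build (l2Z X) l2Z_complete.

End l2Z_complete.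

Section bilateral_shift.
Variable X : normedModType R[i].

Lemma sqr_sum_shift (u : int -> X) : sqr_sum (fun n => u (n - 1)) = sqr_sum u.
Proof.
rewrite /sqr_sum [RHS](reindex_esum [set: int] _ (fun n => n - 1))//.
split => // [n m _ _ /addIr//|n _].
by exists (n + 1) => //; rewrite addrK.
Qed.

Lemma shift_l2Z_subproof (u : l2Z X) : (fun n => u (n - 1)) \in @l2Z_pred X.
Proof. by rewrite l2Z_predE sqr_sum_shift -l2Z_predE l2Z_subproof. Qed.

Definition shift_l2Z (u : l2Z X) : l2Z X := L2Z (shift_l2Z_subproof u).

Let shift_l2Z_linear : linear shift_l2Z.
Proof. by move=> a u v; exact: l2Z_ext. Qed.

Lemma shift_l2Z_op_subproof : shift_l2Z \in @bounded_op_pred R (l2Z X) (l2Z X).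
Proof.
apply/asboolP; split => //.
pose f : {linear l2Z X -> l2Z X} := HB.pack shift_l2Z
  (GRing.isLinear.Build R[i] (l2Z X) (l2Z X) *:%R shift_l2Z shift_l2Z_linear).
apply: (@bounded_linear_continuous _ _ _ f); apply/bounded_funP => r.
exists r => u; apply: le_trans.
by rewrite -!nrmE lecR !nrm_l2ZE /l2norm sqr_sum_shift.
Qed.

Definition bilateral_shift : bounded_op (l2Z X) (l2Z X) :=
  BoundedOp shift_l2Z_op_subproof.

End bilateral_shift.
End l2Z.

(* Main.v *)
(* The duality map J is additive exactly when X is Hilbert, since then
   <x, y> = J y x is an inner product; and it is always conjugate-homogeneous.
   (2) => (1): T y = (J v y) v has T_* z = conj (J z v) v, so linearity of T_*
   says that z |-> J z v is additive.
   (3) => (1): J acts coordinatewise on l2(Z, X), and U_* is the inverse shift;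
   comparing the coordinates at 0 of J (u + U_* u) and J u + J u o U, for u with
   entries x at 0 and y at 1, gives J (x + y) = J x + J y.
   Both follow from describing support functionals at x as the subgradients of
   |.|^2 / 2 at x, which splits over coordinates. The converse implications are
   computations with inner products; l2(Z, X) is Hilbert because the real
   polarization identity of X can be summed over the coordinates. *)

Require Import Defs.
From HB Require Import structures.
From mathcomp Require Import all_boot all_order all_algebra.
From mathcomp Require Import finmap ring lra.
From mathcomp Require Import complex.
From mathcomp Require Import all_classical all_reals all_analysis.

Set Implicit Arguments.
Unset Strict Implicit.
Unset Printing Implicit Defensive.

Import Order.TTheory GRing.Theory Num.Theory.
Import numFieldNormedType.Exports.

Local Open Scope classical_set_scope.
Local Open Scope ring_scope.
Local Open Scope complex_scope.

(** First-variation argument: a linear term dominated by a quadratic one vanishes. At [t = a / c]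
    with [c > 0] and [c >= b], the bound gives [2 * (a ^+ 2 / c) <= a ^+ 2 / c]. *)
Lemma linear_term_eq0 (R : realFieldType) (a b : R) :
  (forall t, 2 * t * a <= t ^+ 2 * b) -> a = 0.
Proof.
move=> H; pose c := `|b| + 1.
have c0 : 0 < c by rewrite ltr_wpDl.
have bc : b <= c by rewrite (le_trans (ler_norm b))// lerDl.
have := H (a / c); have -> : 2 * (a / c) * a = 2 * (a ^+ 2 / c) by ring.
have -> : (a / c) ^+ 2 * b = a ^+ 2 / c * (b / c) by field; rewrite gt_eqF.
have d0 : 0 <= a ^+ 2 / c by rewrite divr_ge0 ?sqr_ge0// ltW.
have e1 : b / c <= 1 by rewrite ler_pdivrMr// mul1r.
move=> h; have : a ^+ 2 / c <= 0 by nra.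
rewrite ler_pdivrMr// mul0r => a2.
by apply/eqP; rewrite -sqrf_eq0 eq_le a2 sqr_ge0.
Qed.

(** * Real parts and moduli of complex numbers *)

Section complex_numbers.
Context {R : realType}.
Implicit Types (t : R) (z w : R[i]).

Lemma Re_add z w : complex.Re (z + w) = complex.Re z + complex.Re w.
Proof. by case: z; case: w. Qed.

Lemma Re_sub z w : complex.Re (z - w) = complex.Re z - complex.Re w.
Proof. by case: z; case: w. Qed.

Lemma Re_scale t z : complex.Re (t%:C * z) = t * complex.Re z.
Proof. by case: z => a b /=; rewrite mul0r subr0. Qed.

Lemma Re_mulNi z : complex.Re (- 'i * z) = complex.Im z.
Proof. by case: z => a b /=; rewrite oppr0 mul0r sub0r mulN1r opprK. Qed.

Lemma Re_norm_real t : complex.Re `|t%:C| = `|t|.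
Proof. by rewrite normc_def /= expr0n addr0 sqrtr_sqr. Qed.

Lemma Re_norm_i : complex.Re `|'i : R[i]| = 1.
Proof. by rewrite normc_def /= expr0n add0r expr1n sqrtr1. Qed.

Lemma sqr_Re_norm z :
  complex.Re `|z| ^+ 2 = complex.Re z ^+ 2 + complex.Im z ^+ 2.
Proof. by rewrite normc_def sqr_sqrtr ?addr_ge0 ?sqr_ge0. Qed.

End complex_numbers.

Section real_norm.
Context {R : realType} {E : normedModType R[i]}.
Implicit Types x y : E.

Lemma sqr_nrmZr (t : R) x : nrm (t%:C *: x) ^+ 2 = t ^+ 2 * nrm x ^+ 2.
Proof. by rewrite nrmZ Re_norm_real exprMn real_normK ?num_real. Qed.

Lemma nrmZi x : nrm ('i *: x) = nrm x.
Proof. by rewrite nrmZ Re_norm_i mul1r. Qed.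

Lemma nrm_gt0 x : x != 0 -> 0 < nrm x.
Proof.
by move=> x0; rewrite lt_def nrm_ge0 andbT; apply: contra_neq x0 => /nrm_eq0.
Qed.

End real_norm.

(* [subgrad x f] says that [f] is a subgradient of [|.|^2 / 2] at [x]. *)
Definition subgrad {R : realType} {E : normedModType R[i]} (x : E)
    (f : E -> R[i]) : Prop :=
  forall y, 2 * complex.Re (f (y - x)) <= nrm y ^+ 2 - nrm x ^+ 2.

(** * Subgradients of half the squared norm and support functionals *)

Section subgradients.
Context {R : realType} {E : normedModType R[i]}.
Implicit Types (x y : E).

Section linear_functional.
Variables (f : {linear E -> R[i]^o}) (x : E).
Hypothesis fx : subgrad x f.

Let linZ (a : R[i]) y : f (a *: y) = a * f y.
Proof. by rewrite linearZ. Qed.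

(** Along the ray [(1 + t) x] the squared norm is [(1 + t) ^+ 2 * nrm x ^+ 2], so its first
    variation at [t = 0] determines [Re (f x)]. *)
Lemma subgrad_Re : complex.Re (f x) = nrm x ^+ 2.
Proof.
apply/eqP; rewrite -subr_eq0; apply/eqP.
apply: (@linear_term_eq0 _ _ (nrm x ^+ 2)) => t.
have := fx ((1 + t)%:C *: x).
rewrite rmorphD/= scalerDl scale1r addrAC subrr add0r linZ Re_scale.
rewrite -[X in nrm (X + _)]scale1r -scalerDl -(rmorphD (@real_complex R)).
rewrite sqr_nrmZr.
lra.
Qed.

Lemma subgrad_Re_le y : complex.Re (f y) <= nrm x * nrm y.
Proof.
have H z : 2 * complex.Re (f z) <= nrm x ^+ 2 + nrm z ^+ 2.
  by have := fx z; rewrite linearB Re_sub subgrad_Re; lra.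
have [->|y0] := eqVneq y 0; first by rewrite linear0 nrm0 mulr0.
have yp := nrm_gt0 y0; have [x0|xp] := leP (nrm x) 0.
  have {}x0 : nrm x = 0 by apply/eqP; rewrite eq_le x0 nrm_ge0.
  suff -> : complex.Re (f y) = 0 by rewrite x0 mul0r.
  apply: (@linear_term_eq0 _ _ (nrm y ^+ 2)) => t.
  have := H (t%:C *: y); rewrite linZ Re_scale sqr_nrmZr x0; lra.
(* Rescaling [y] to the norm of [x] makes the right-hand side of [H] equal to [2 * nrm x ^+ 2]. *)
have := H ((nrm x / nrm y)%:C *: y); rewrite linZ Re_scale sqr_nrmZr.
have -> : (nrm x / nrm y) ^+ 2 * nrm y ^+ 2 = nrm x ^+ 2.
  by field; rewrite gt_eqF.
have -> : nrm x / nrm y * complex.Re (f y) = nrm x * (complex.Re (f y) / nrm y).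
  by ring.
move=> h; rewrite -ler_pdivrMr//.
have {h} : nrm x * (complex.Re (f y) / nrm y) <= nrm x * nrm x by lra.
by rewrite ler_pM2l.
Qed.

(** The bound on real parts is applied to [conjc (f y) *: y], where [f] takes the real value
    [|f y| ^+ 2]; one factor [|f y|] then cancels. *)
Lemma subgrad_norm_le y : complex.Re `|f y| <= nrm x * nrm y.
Proof.
have [|N0] := leP (complex.Re `|f y|) 0.
  by move/le_trans; apply; rewrite mulr_ge0 ?nrm_ge0.
have := subgrad_Re_le (conjc (f y) *: y).
rewrite linZ nrmZ normcJ mulrC -sqr_normc -{1}Re_normE -rmorphXn /= expr2.
by rewrite mulrCA ler_pM2l.
Qed.

(** The modulus of [f x] is at most [nrm x ^+ 2], which is already its real part, so no imaginary
    part is left. *)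
Lemma subgrad_value : f x = (nrm x ^+ 2)%:C.
Proof.
apply/eqP; rewrite eq_complex subgrad_Re eqxx /=.
have := subgrad_norm_le x; rewrite -expr2 -ler_sqr ?nnegrE ?sqr_ge0//; last first.
  by rewrite -lecR Re_normE normr_ge0.
rewrite sqr_Re_norm subgrad_Re -subr_ge0 opprD addNKr oppr_ge0 => h.
by rewrite -sqrf_eq0 eq_le h sqr_ge0.
Qed.

End linear_functional.

Lemma nrm_dual (f : dual E) y : nrm (f y : R[i]^o) = complex.Re `|f y|.
Proof. by []. Qed.

Lemma nrm_opnorm (f : dual E) : nrm f = opnorm f.
Proof. by []. Qed.

Lemma normr_nrm (F G : normedModType R[i]) (x : F) (y : G) :
  (`|x| = `|y|) <-> (nrm x = nrm y).
Proof. by rewrite -!nrmE; split => [/complexI|->]. Qed.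

(** Forward, [Re (f y) <= nrm x * nrm y] is at most half of [nrm x ^+ 2 + nrm y ^+ 2]. Backward,
    [subgrad_norm_le] bounds the norm of [f] and the value at [x] shows that the bound is
    attained. *)
Lemma support_subgrad (f : dual E) x : support_functional x f <-> subgrad x f.
Proof.
split=> [[nf fx] y|fx].
  have nf' : nrm f = nrm x by apply/normr_nrm.
  have := nrm_bounded_op f y; rewrite -nrm_opnorm nf' nrm_dual => le.
  have -> : f (y - x) = f y - f x by rewrite linearB.
  rewrite Re_sub fx -nrmE -rmorphXn /=.
  have := sqr_ge0 (nrm x - nrm y); have : complex.Re (f y) <= complex.Re `|f y|.
    by apply: (le_trans (ler_norm _)); rewrite -lecR Re_normE normc_ge_Re.
  nra.
have val := subgrad_value fx.
split; last by rewrite val -nrmE -rmorphXn.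
apply/normr_nrm; apply/eqP; rewrite eq_le nrm_opnorm; apply/andP; split.
  apply: opnorm_le => y y1; rewrite nrm_dual (le_trans (subgrad_norm_le fx y))//.
  by rewrite -[leRHS]mulr1 ler_wpM2l ?nrm_ge0.
have [->|x0] := eqVneq x 0.
  by rewrite nrm0 -nrm_opnorm nrm_ge0.
have := nrm_bounded_op f x.
by rewrite nrm_dual val Re_norm_real ger0_norm ?sqr_ge0// expr2 ler_pM2r// nrm_gt0.
Qed.

Lemma bounded_op_of_le (F : normedModType R[i]) (f : E -> F) (k : R) :
  linear f -> (forall y, nrm (f y) <= k * nrm y) -> f \in @bounded_op_pred R E F.
Proof.
move=> lf fk; apply/asboolP; split => //.
pose g : {linear E -> F} := HB.pack f (GRing.isLinear.Build R[i] E F *:%R f lf).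
apply: (@bounded_linear_continuous _ _ _ g); apply/linear_boundedP.
exists (`|k|%:C); split; first by rewrite complex_real.
move=> r kr y; apply: le_trans (_ : `|k|%:C * `|y| <= _).
  rewrite -!nrmE -rmorphM/= lecR (le_trans (fk y))// ler_wpM2r ?nrm_ge0//.
  exact: ler_norm.
by rewrite ler_wpM2r// ltW.
Qed.

(** Builds support functionals from merely linear maps: continuity follows from the subgradient
    inequality. *)
Lemma support_of_subgrad (f : E -> R[i]) x :
  linear (f : E -> R[i]^o) -> subgrad x f ->
  exists2 g : dual E, support_functional x g & g =1 f.
Proof.
move=> lf fx.
pose f' : {linear E -> R[i]^o} := HB.pack (f : E -> R[i]^o)
  (GRing.isLinear.Build R[i] E R[i]^o *:%R (f : E -> R[i]^o) lf).
have fb : (f : E -> R[i]^o) \in @bounded_op_pred R E R[i]^o.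
  by apply: (@bounded_op_of_le _ _ (nrm x)) => // y; exact: (@subgrad_norm_le f').
by exists (BoundedOp fb) => //; apply/support_subgrad.
Qed.

End subgradients.

(** * Uniqueness of support functionals and default values of the duality map *)

Section duality_map_facts.
Context {R : realType} {E : normedModType R[i]}.
Implicit Types (x y : E) (f g : dual E).

Lemma support0 f : support_functional (0 : E) f -> f = 0.
Proof. by move=> [f0 _]; apply/normr0_eq0; rewrite f0 normr0. Qed.

Lemma smooth_support_inj x f g : smooth_space E ->
  support_functional x f -> support_functional x g -> f = g.
Proof.
move=> smE; have [->|x0] := eqVneq x 0; first by move=> /support0 -> /support0 ->.
by have [h [_ uniq]] := smE x x0 => /uniq <- /uniq <-.
Qed.

(** Since [f (x + y)] is twice [nrm x ^+ 2] and [f] has norm [nrm x], the vector [x + y] has norm at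
    least [2 * nrm x]. If [x != y], this contradicts strict convexity after normalization. *)
Lemma strictly_convex_support_inj x y f : strictly_convex_space E ->
  support_functional x f -> support_functional y f -> x = y.
Proof.
move=> scE [nx fx] [ny fy]; have exy : `|x| = `|y| by rewrite -nx ny.
have [x0|x0] := eqVneq x 0.
  by apply/esym; rewrite x0; apply/normr0_eq0; rewrite -exy x0 normr0.
apply/eqP/negPn/negP => xy.
have n0 : `|x| != 0 by rewrite normr_eq0.
have unit (z : E) : `|z| = `|x| -> `| `|x|^-1 *: z | = 1.
  by move=> zx; rewrite normrZ normfV normr_id zx mulVf.
have neq : `|x|^-1 *: x != `|x|^-1 *: y.
  by apply: contra_neq xy; apply: scalerI; rewrite invr_eq0.
have := scE _ _ (unit x erefl) (unit y (esym exy)) neq.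
rewrite -scalerDr normrZ normfV normr_id mulrC ltr_pdivrMr ?normr_gt0//.
apply/negP; rewrite -real_leNgt ?realM ?normr_real ?realn//.
have nf : nrm f = nrm x by apply/normr_nrm.
have := nrm_bounded_op f (x + y); rewrite -nrm_opnorm nf nrm_dual => le.
have fxy : f (x + y) = ((nrm x ^+ 2) *+ 2)%:C.
  rewrite linearD /= fx fy -exy -nrmE mulr2n rmorphD/= rmorphXn /=.
  by [].
move: le; rewrite fxy Re_norm_real ger0_norm ?mulrn_wge0 ?sqr_ge0//.
rewrite -mulr_natr expr2 -mulrA ler_pM2l ?nrm_gt0// => le.
by rewrite -!nrmE -(rmorph_nat (@real_complex R)) -rmorphM/= lecR mulrC.
Qed.

Lemma duality_map_support x f :
  support_functional x f -> support_functional x (duality_map x).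
Proof. by move=> xf; apply: xgetPex; exists f. Qed.

Lemma duality_map_neq0 x : duality_map x != 0 ->
  support_functional x (duality_map x).
Proof. by rewrite /duality_map; case: xgetP => [f _ //|_]; rewrite eqxx. Qed.

Lemma duality_map_inv_neq0 f : duality_map_inv f != 0 ->
  duality_map (duality_map_inv f) = f.
Proof.
by rewrite /duality_map_inv; case: xgetP => [x _ //|_]; rewrite eqxx.
Qed.

Lemma duality_map_inv0 f : (forall x, duality_map x <> f) -> duality_map_inv f = 0.
Proof. by move=> nf; rewrite /duality_map_inv; case: xgetP => // x _ /nf. Qed.

(* The hypothesis [x != 0] excludes [f = 0], which [duality_map] also takes as
   a junk value at points without support functional. *)
Lemma duality_map_invE x f :
  (forall y, support_functional y f -> x = y) ->
  x != 0 -> support_functional x f ->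
  (forall g, support_functional x g -> g = f) -> duality_map_inv f = x.
Proof.
move=> inj x0 xf uniq.
have f0 : f != 0.
  apply: contra_neq x0 => f0; apply/normr0_eq0; have [<- _] := xf.
  by rewrite f0 normr0.
have : exists y, duality_map y = f.
  by exists x; apply: uniq; exact: duality_map_support xf.
move=> /(xgetPex 0); rewrite -/(duality_map_inv f) /= => e.
have yf : support_functional (duality_map_inv f) f.
  by have := @duality_map_neq0 (duality_map_inv f); rewrite e; apply.
exact/esym/inj.
Qed.

Lemma support_scale x f (c : R[i]) :
  support_functional x f -> support_functional (c *: x) (conjc c *: f).
Proof.
move=> [nf fx]; split; first by rewrite !normrZ normcJ nf.
have -> : (conjc c *: f) (c *: x) = conjc c * f (c *: x) by [].
have -> : f (c *: x) = c * f x by rewrite linearZ.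
by rewrite fx normrZ exprMn sqr_normc; ring.
Qed.

End duality_map_facts.

(* Hermitian symmetry and linearity on the left encode [{dot E for conj}]
   without its canonical structures. *)
Definition inner_form {R : realType} {E : normedModType R[i]}
    (B : E -> E -> R[i]) : Prop :=
  [/\ forall a x y z, B (a *: x + y) z = a * B x z + B y z,
      forall x y, B x y = conjc (B y x) &
      forall x, B x x = (nrm x ^+ 2)%:C].

Lemma is_hilbertP (R : realType) (E : normedModType R[i]) :
  is_hilbert E <-> exists B : E -> E -> R[i], inner_form B.
Proof.
split=> [[ip ipE]|[B [Bl Bh BB]]].
  exists ip; split.
  - by move=> a x y z; rewrite linearPl.
  - by move=> x y; rewrite [LHS]hermitian_subproof expr0 mul1r.
  - by move=> x; rewrite -ipE -nrmE rmorphXn.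
have Br x a y z : B x (a *: y + z) = conjc a * B x y + B x z.
  by rewrite Bh Bl rmorphD rmorphM /= -!Bh.
have bil : bilinear_for (GRing.Scale.Law.clone _ _ *%R _)
   (GRing.Scale.Law.clone _ _ (@Num.conj R[i] \; *%R) _) B.
  by split=> [z a x y|z a x y] /=; [exact: Bl|exact: Br].
have pos x : x != 0 -> 0 < B x x.
  by move=> x0; rewrite BB -[0]/(0%:C) ltcR exprn_gt0// nrm_gt0.
have herm x y : B x y = (-1) ^+ false * Num.conj (B y x).
  by rewrite expr0 mul1r.
pose ip : {dot E for @Num.conj R[i]} := HB.pack B
  (bilinear_isBilinear.Build _ _ _ _ _ _ B bil)
  (isHermitianSesquilinear.Build _ _ false (@Num.conj R[i]) B herm)
  (isDotProduct.Build _ _ B pos).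
by exists ip => x; rewrite /= BB -nrmE -rmorphXn.
Qed.

(** * Duality map and adjoints in the presence of an inner product *)

Section inner_form_facts.
Context {R : realType} {E : normedModType R[i]} (B : E -> E -> R[i]).
Hypothesis Bin : inner_form B.
Implicit Types (x y z : E) (f : dual E).

Lemma inner_linearl a x y z : B (a *: x + y) z = a * B x z + B y z.
Proof. by have [+ _ _] := Bin; apply. Qed.

Lemma inner_herm x y : B x y = conjc (B y x).
Proof. by have [_ + _] := Bin; apply. Qed.

Lemma inner_norm x : B x x = (nrm x ^+ 2)%:C.
Proof. by have [_ _ +] := Bin; apply. Qed.

Lemma inner_linearr a x y z : B x (a *: y + z) = conjc a * B x y + B x z.
Proof. by rewrite inner_herm inner_linearl rmorphD rmorphM /= -!inner_herm. Qed.

Lemma inner_Dr x y z : B x (y + z) = B x y + B x z.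
Proof. by rewrite -{1}[y]scale1r inner_linearr rmorph1 mul1r. Qed.

Lemma inner_Dl x y z : B (x + y) z = B x z + B y z.
Proof. by rewrite -{1}[x]scale1r inner_linearl mul1r. Qed.

Lemma inner0l z : B 0 z = 0.
Proof. by apply: (addrI (B 0 z)); rewrite -inner_Dl !addr0. Qed.

Lemma inner0r z : B z 0 = 0.
Proof. by rewrite inner_herm inner0l rmorph0. Qed.

Lemma inner_Zl a x z : B (a *: x) z = a * B x z.
Proof. by rewrite -[a *: x]addr0 inner_linearl inner0l addr0. Qed.

Lemma inner_Zr a x z : B x (a *: z) = conjc a * B x z.
Proof. by rewrite -[a *: z]addr0 inner_linearr inner0r addr0. Qed.

Lemma inner_Re_sym x y : complex.Re (B x y) = complex.Re (B y x).
Proof. by rewrite inner_herm; case: (B y x). Qed.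

Lemma sqr_nrmD x y :
  nrm (x + y) ^+ 2 = nrm x ^+ 2 + nrm y ^+ 2 + 2 * complex.Re (B x y).
Proof.
have nE z : nrm z ^+ 2 = complex.Re (B z z) by rewrite inner_norm.
rewrite !nE inner_Dl !inner_Dr !Re_add (inner_Re_sym y x); ring.
Qed.

Lemma inner_injr x y : (forall z, B z x = B z y) -> x = y.
Proof.
move=> xy; apply/eqP; rewrite -subr_eq0 -(scaleN1r y); apply/eqP/nrm_eq0/eqP.
rewrite -sqrf_eq0; apply/eqP/complexI; rewrite -inner_norm.
by rewrite inner_Dr inner_Zr xy rmorphN rmorph1 mulN1r subrr.
Qed.

Lemma inner_subgrad x : subgrad x (B^~ x).
Proof.
move=> y; have := sqr_nrmD x (y - x); rewrite addrC subrK => ->.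
rewrite inner_Re_sym; have := sqr_ge0 (nrm (y - x)); lra.
Qed.

Lemma inner_supportP x f : support_functional x f <-> forall y, f y = B y x.
Proof.
split=> [/support_subgrad fx|fB]; last first.
  by apply/support_subgrad => y; rewrite fB; exact: inner_subgrad.
have H y : complex.Re (f y) = complex.Re (B y x).
  apply/eqP; rewrite -subr_eq0; apply/eqP.
  apply: (@linear_term_eq0 _ _ (nrm y ^+ 2)) => t.
  have := fx (x + t%:C *: y); rewrite addrAC subrr add0r.
  have -> : f (t%:C *: y) = t%:C * f y by rewrite linearZ.
  rewrite sqr_nrmD sqr_nrmZr Re_scale inner_Re_sym inner_Zl Re_scale; lra.
(* Real parts at [- 'i *: y] are imaginary parts at [y]. *)
move=> y; have := H (- 'i *: y).
have -> : f (- 'i *: y) = - 'i * f y by rewrite linearZ.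
rewrite inner_Zl !Re_mulNi; have := H y.
by case: (f y) (B y x) => [a b] [c d] /= -> ->.
Qed.

Lemma inner_support_exists x : exists2 f : dual E,
  support_functional x f & forall y, f y = B y x.
Proof.
apply: support_of_subgrad; last exact: inner_subgrad.
by move=> a y z; rewrite inner_linearl.
Qed.

Lemma inner_duality_map x y : duality_map x y = B y x.
Proof.
have [f xf _] := inner_support_exists x.
by have /inner_supportP := duality_map_support xf; apply.
Qed.

Lemma inner_duality_map_inv x f :
  (forall y, f y = B y x) -> duality_map_inv f = x.
Proof.
move=> fB; have : exists z, duality_map z = f.
  by exists x; apply: bounded_op_ext => y; rewrite inner_duality_map fB.
move=> /(xgetPex 0); rewrite -/(duality_map_inv f) /= => e.
by apply: inner_injr => z; rewrite -inner_duality_map e.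
Qed.

Lemma inner_adjointE (T : bounded_op E E) x z :
  (forall y, B (T y) x = B y z) -> adjoint T x = z.
Proof.
by move=> Txz; apply: inner_duality_map_inv => y; rewrite -Txz -inner_duality_map.
Qed.

(* If no [w] represents the functional of [T], then [adjoint T] is zero, taking
   the junk value of [duality_map_inv] wherever [B v x != 0]. *)
Lemma inner_adjoint_rank_one (T : bounded_op E E) (v : E) :
  (forall y, exists c, T y = c *: v) -> linear (adjoint T).
Proof.
move=> Tv; have [[w Tw]|noT] := pselect (exists w, forall y, T y = B y w *: v).
  have adjE x : adjoint T x = B x v *: w.
    by apply: inner_adjointE => y; rewrite Tw inner_Zl inner_Zr -inner_herm mulrC.
  by move=> a x y; rewrite !adjE inner_linearl scalerDl scalerA.
suff adj0 x : adjoint T x = 0 by move=> a x y; rewrite !adj0 scaler0 addr0.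
have [vx|vx] := eqVneq (B v x) 0.
  apply: inner_adjointE => y; have [c ->] := Tv y.
  by rewrite inner_Zl vx mulr0 inner0r.
apply: duality_map_inv0 => z zT; apply: noT.
(* From [B y z = B (T y) x = c * B v x], dividing by [B v x] recovers the coefficient [c]; the
   conjugate offsets antilinearity on the right. *)
exists (conjc (B v x)^-1 *: z) => y; have [c Ty] := Tv y.
have : B y z = B (T y) x by rewrite -!inner_duality_map zT.
by rewrite inner_Zr conjcK Ty inner_Zl => ->; rewrite mulrCA mulVf ?mulr1.
Qed.

End inner_form_facts.

(** Real linearity in the first argument of the polar form of [nrm ^+ 2], written as a linear
    relation between squared norms so that it can be summed over coordinates. *)
Definition real_quadratic {R : realType} (E : normedModType R[i]) : Prop :=
  forall (a : R) (x y z : E), nrm (a%:C *: x + y + z) ^+ 2 =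
    nrm (a%:C *: x + y) ^+ 2 + nrm z ^+ 2 +
    a * (nrm (x + z) ^+ 2 - nrm x ^+ 2 - nrm z ^+ 2) +
    (nrm (y + z) ^+ 2 - nrm y ^+ 2 - nrm z ^+ 2).

(** * Two criteria for a norm to come from an inner product *)

Section hilbert_criteria.
Context {R : realType} {E : normedModType R[i]}.

Lemma hilbert_real_quadratic : is_hilbert E -> real_quadratic E.
Proof.
move=> /is_hilbertP[B Bin] a x y z.
rewrite (sqr_nrmD Bin (_ + y) z) (sqr_nrmD Bin x z) (sqr_nrmD Bin y z).
rewrite (inner_linearl Bin) Re_add Re_scale; ring.
Qed.

(** The polar form [r] is a real inner product invariant under multiplication by ['i]; its
    complexification [r x y - 'i * r ('i *: x) y] is the required form. *)
Lemma real_quadratic_hilbert : real_quadratic E -> is_hilbert E.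
Proof.
move=> Q; pose r (x z : E) := (nrm (x + z) ^+ 2 - nrm x ^+ 2 - nrm z ^+ 2) / 2.
have rP a x y z : r (a%:C *: x + y) z = a * r x z + r y z.
  by rewrite /r Q; field.
have rC x z : r x z = r z x by rewrite /r [x + z]addrC; ring.
have r0 z : r 0 z = 0 by rewrite /r add0r nrm0; ring.
have rN x z : r (- x) z = - r x z.
  by have := rP (-1) x 0 z; rewrite rmorphN1 scaleN1r addr0 r0 addr0 mulN1r.
have rD x y z : r (x + y) z = r x z + r y z.
  by have := rP 1 x y z; rewrite scale1r mul1r.
have rI x z : r ('i *: x) ('i *: z) = r x z.
  by rewrite /r -scalerDr !nrmZi.
have ii x : 'i *: ('i *: x) = - x :> E.
  by rewrite scalerA -expr2 sqr_i scaleN1r.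
(* Skew symmetry of the imaginary part: it gives Hermitian symmetry, and vanishing on the
   diagonal. *)
have rJ x y : r ('i *: x) y = - r ('i *: y) x.
  by rewrite -rI ii rN rC.
apply/is_hilbertP; exists (fun x y => (r x y) +i* (- r ('i *: x) y)).
split=> [[p q] x y z|x y|x] /=.
- have e : (p +i* q) *: x = p%:C *: x + q%:C *: ('i *: x).
    by rewrite scalerA -scalerDl [p +i* q]complexE /= [_ * 'i]mulrC.
  have e' : 'i *: ((p +i* q) *: x) = p%:C *: ('i *: x) + (- q)%:C *: x.
    rewrite !scalerA -scalerDl; congr (_ *: _).
    by apply/eqP; rewrite eq_complex /=; apply/andP; split; apply/eqP; ring.
  rewrite scalerDr e' e -!addrA !rP.
  by apply/eqP; rewrite eq_complex /=; apply/andP; split; apply/eqP; ring.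
- by rewrite rJ [r x y]rC.
- have -> : r ('i *: x) x = 0 by have := rJ x x; lra.
  rewrite oppr0; congr (_%:C); rewrite /r -mulr2n -scaler_nat.
  by rewrite -(rmorph_nat (@real_complex R)) sqr_nrmZr; field.
Qed.

Lemma duality_map_scale (smE : smooth_space E) (c : R[i]) (x : E) :
  duality_map (c *: x) = conjc c *: duality_map x.
Proof.
apply: (smooth_support_inj smE); first exact: duality_mapP.
exact/support_scale/duality_mapP.
Qed.

(** The point to check is Hermitian symmetry of [B]: diagonal values are real, so expanding
    [B (x + y) (x + y)] makes [B x y + B y x] real, also with ['i *: x] for [x]. *)
Lemma duality_map_additive_hilbert : smooth_space E ->
  (forall x y z : E, duality_map (x + y) z = duality_map x z + duality_map y z) ->
  is_hilbert E.
Proof.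
move=> smE Jadd; pose B (x y : E) : R[i] := duality_map y x.
have Bl a x y z : B (a *: x + y) z = a * B x z + B y z by rewrite /B linearP.
have Bd x y z : B x (y + z) = B x y + B x z by exact: Jadd.
have BZ a x y : B x (a *: y) = conjc a * B x y by rewrite /B duality_map_scale.
have BB x : B x x = (nrm x ^+ 2)%:C.
  by have [_ e] := duality_mapP x smE; rewrite [LHS]e -nrmE rmorphXn.
have B0 z : B 0 z = 0 by rewrite /B linear0.
have Bz a x z : B (a *: x) z = a * B x z.
  by rewrite -[a *: x]addr0 Bl B0 addr0.
have Im0 x y : complex.Im (B x y + B y x) = 0.
  have : complex.Im (B (x + y) (x + y)) = 0 by rewrite BB.
  have -> : B (x + y) (x + y) =
      (nrm x ^+ 2)%:C + (nrm y ^+ 2)%:C + (B x y + B y x).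
    by rewrite -{1}[x]scale1r Bl mul1r !Bd !BB; ring.
  by case: (_ + B y x) => c d /=; rewrite !add0r.
apply/is_hilbertP; exists B; split => // x y.
(* [B x y + B y x] and ['i * (B x y - B y x)] are both real. *)
have := Im0 x y; have := Im0 ('i *: x) y; rewrite Bz BZ.
case: (B x y) (B y x) => [a b] [c d] /=.
move=> h1 h2; apply/eqP; rewrite eq_complex /=.
by apply/andP; split; apply/eqP; lra.
Qed.

End hilbert_criteria.

(** * Squared norms and support functionals on the space of bi-sequences *)

Section l2Z_facts.
Context {R : realType} {X : normedModType R[i]}.
Implicit Types (u v w : l2Z X) (x y : X).

Lemma l2Z_addE u v n : (u + v) n = u n + v n. Proof. by []. Qed.
Lemma l2Z_subE u v n : (u - v) n = u n - v n. Proof. by []. Qed.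
Lemma l2Z_scaleE (a : R[i]) u n : (a *: u) n = a *: u n. Proof. by []. Qed.

Lemma sqr_sum_nrm u : sqr_sum u = (nrm u ^+ 2)%:E.
Proof. by rewrite sqr_sumE ?l2Z_subproof. Qed.

Lemma l2Z_partial_le u (A : {fset int}) :
  \sum_(n <- A) nrm (u n) ^+ 2 <= nrm u ^+ 2.
Proof.
rewrite -lee_fin -sqr_sum_nrm; apply: esum_ge; exists [set` A].
  by split => //; exact: finite_fset.
by rewrite fsbig_finite ?finite_fset//= set_fsetK sumEFin.
Qed.

(** Partial sums grow with the index set, so the union of the sets found for each sequence serves
    all of them at once. *)
Lemma l2Z_approx (s : seq (l2Z X)) (e : R) : 0 < e ->
  exists A : {fset int}, forall u, u \in s ->
    nrm u ^+ 2 - e <= \sum_(n <- A) nrm (u n) ^+ 2.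
Proof.
move=> e0; elim: s => [|u s [A sA]]; first by exists fset0.
have : ((nrm u ^+ 2 - e)%:E < sqr_sum u)%E.
  by rewrite sqr_sum_nrm lte_fin ltrBlDr ltrDl.
move=> /ereal_sup_gt[_ [C [finC _] <-]].
rewrite fsbig_finite//= sumEFin lte_fin => uC.
have mono v (D F : {fset int}) : (D `<=` F)%fset ->
    \sum_(n <- D) nrm (v n) ^+ 2 <= \sum_(n <- F) nrm (v n) ^+ 2.
  move=> DF; rewrite (big_fsetID _ (mem D) F) /=.
  have -> : [fset x in F | x \in D]%fset = D.
    apply/fsetP => n; rewrite !inE /= andbC.
    by case: (boolP (n \in D)) => // /(fsubsetP DF) ->.
  by rewrite lerDl sumr_ge0// => n _; rewrite sqr_ge0.
exists (A `|` fset_set C)%fset => v; rewrite inE => /predU1P[->|vs].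
  by rewrite (le_trans (ltW uC))// mono// fsubsetUr.
by rewrite (le_trans (sA v vs))// mono// fsubsetUl.
Qed.

(** Truncation to a finite set [A] makes the sum nonpositive by hypothesis, and costs at most
    [e / c] per unit of absolute weight, hence at most [e]. *)
Lemma l2Z_sqr_nrm_le0 (s : seq (R * l2Z X)) :
  (forall n, \sum_(p <- s) p.1 * nrm (p.2 n) ^+ 2 <= 0) ->
  \sum_(p <- s) p.1 * nrm p.2 ^+ 2 <= 0.
Proof.
move=> s0; pose c := \sum_(p <- s) `|p.1| + 1.
have c0 : 0 < c by rewrite ltr_wpDl// sumr_ge0.
apply/ler_addgt0Pr => e e0; rewrite add0r.
have [A HA] := l2Z_approx [seq p.2 | p <- s] (divr_gt0 e0 c0).
have le p : p \in s -> p.1 * nrm p.2 ^+ 2 <=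
    \sum_(n <- A) p.1 * nrm (p.2 n) ^+ 2 + `|p.1| * (e / c).
  move=> ps; rewrite -mulr_sumr.
  have := HA p.2 (map_f _ ps); have := l2Z_partial_le p.2 A.
  set S := \sum_(n <- A) _; set N := nrm _ ^+ 2; set d := e / c => SN NS.
  have d0 : 0 <= d by rewrite divr_ge0// ltW.
  (* Nonnegative weights use the approximation by [A]; negative ones use that a partial sum never
     exceeds the full one. *)
  have [p0|p0] := leP 0 p.1.
    by rewrite ger0_norm// -mulrDr ler_wpM2l// -lerBlDr.
  apply: (@le_trans _ _ (p.1 * S)); first by rewrite ler_wnM2l// ltW.
  by rewrite lerDl mulr_ge0.
rewrite big_seq (le_trans (ler_sum _ le))// -big_seq big_split /= exchange_big /=.
rewrite -[leRHS]add0r lerD//; first by rewrite sumr_le0.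
rewrite -mulr_suml mulrA ler_pdivrMr// mulrC ler_wpM2l//; first exact: ltW.
by rewrite /c lerDl.
Qed.

Lemma l2Z_sqr_nrm_eq0 (s : seq (R * l2Z X)) :
  (forall n, \sum_(p <- s) p.1 * nrm (p.2 n) ^+ 2 = 0) ->
  \sum_(p <- s) p.1 * nrm p.2 ^+ 2 = 0.
Proof.
move=> s0; apply/eqP; rewrite eq_le; apply/andP; split.
  by apply: l2Z_sqr_nrm_le0 => n; rewrite s0.
rewrite -oppr_le0 -sumrN.
have := @l2Z_sqr_nrm_le0 [seq (- p.1, p.2) | p <- s].
rewrite big_map /=; under eq_bigr do rewrite mulNr; apply => n.
by rewrite big_map /=; under eq_bigr do rewrite mulNr; rewrite sumrN s0 oppr0.
Qed.

Lemma l2Z_real_quadratic : real_quadratic X -> real_quadratic (l2Z X).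
Proof.
move=> Q a u v w.
(* The list holds the terms of the identity for [u], [v], [w], moved to one side. *)
suff : \sum_(p <- [:: (1, a%:C *: u + v + w); (-1, a%:C *: u + v); (-1, w);
    (a, u); (- a, u + w); (a, w); (-1, v + w); (1, v); (1, w)])
    p.1 * nrm p.2 ^+ 2 = 0.
  (* [lra] would unfold the norm of [l2Z X] to compare its atoms. *)
  by rewrite !big_cons big_nil /fst /snd; do 7! move: (nrm _) => ?; lra.
apply: l2Z_sqr_nrm_eq0 => n; rewrite !big_cons big_nil /fst /snd.
by rewrite !l2Z_addE l2Z_scaleE Q; ring.
Qed.

Definition single_fun (m : int) (x : X) (n : int) : X := if n == m then x else 0.

Lemma sqr_sum_single m x : sqr_sum (single_fun m x) = (nrm x ^+ 2)%:E.
Proof.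
rewrite -(@esum_set1 _ _ m (fun=> (nrm x ^+ 2)%:E)) ?lee_fin ?sqr_ge0//.
rewrite [RHS]esum_mkcond; apply: eq_esum => n _.
rewrite /single_fun; case: eqP => [->|nm]; first by rewrite mem_set.
by rewrite memNset// nrm0 expr0n.
Qed.

Lemma single_subproof m x : single_fun m x \in @l2Z_pred R X.
Proof. by rewrite l2Z_predE sqr_sum_single ltry. Qed.

Definition single m x : l2Z X := L2Z (single_subproof m x).

Lemma singleE m x n : single m x n = if n == m then x else 0.
Proof. by []. Qed.

Lemma nrm_single m x : nrm (single m x) = nrm x.
Proof.
apply/eqP; rewrite -(eqrXn2 (n := 2)) ?nrm_ge0//; apply/eqP.
by apply: EFin_inj; rewrite -sqr_sum_nrm sqr_sum_single.
Qed.

Lemma single_linear m : linear (single m).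
Proof.
move=> a x y; apply: l2Z_ext => n; rewrite l2Z_addE l2Z_scaleE !singleE.
by case: eqP; rewrite ?scaler0 ?addr0.
Qed.

Lemma shift_single m x : bilateral_shift X (single m x) = single (m + 1) x.
Proof.
by apply: l2Z_ext => n; rewrite /= /single_fun subr_eq.
Qed.

Lemma unshift_subproof u : (fun n => u (n + 1)) \in @l2Z_pred R X.
Proof.
rewrite l2Z_predE -(sqr_sum_shift (fun n => u (n + 1))).
have -> : (fun n => u (n - 1 + 1)) = u by apply/funext => n; rewrite subrK.
by rewrite -l2Z_predE l2Z_subproof.
Qed.

Definition unshift u : l2Z X := L2Z (unshift_subproof u).

Lemma unshiftK u : bilateral_shift X (unshift u) = u.
Proof. by apply: l2Z_ext => n /=; rewrite subrK. Qed.

Lemma nrm_shift u : nrm (bilateral_shift X u) = nrm u.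
Proof. by rewrite !nrm_l2ZE /l2norm sqr_sum_shift. Qed.

(** The shift is an isometry that sends [unshift u] to [u], so the subgradient inequality at [u]
    pulls back along it. *)
Lemma support_unshift u (f : dual (l2Z X)) : support_functional u f ->
  support_functional (unshift u) (banach_adjoint (bilateral_shift X) f).
Proof.
move=> /support_subgrad fu; apply/support_subgrad => v.
rewrite -(nrm_shift v) -(nrm_shift (unshift u)) unshiftK.
have -> : banach_adjoint (bilateral_shift X) f (v - unshift u) =
    f (bilateral_shift X v - u).
  by rewrite -[in RHS](unshiftK u) -linearB.
exact: fu.
Qed.

(* Replacing the [n]-th coordinate of [u] changes [|u|^2] by the change of the
   squared norm of that coordinate. *)
Lemma support_coordinate u (f : dual (l2Z X)) n : support_functional u f ->
  subgrad (u n) (fun x => f (single n x)).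
Proof.
move=> /support_subgrad fu x; have := fu (u + single n (x - u n)).
rewrite addrAC subrr add0r => h; apply: (le_trans h).
suff : \sum_(p <- [:: (1, u + single n (x - u n)); (-1, u);
    (-1, single n x); (1, single n (u n))]) p.1 * nrm p.2 ^+ 2 = 0.
  rewrite !big_cons big_nil /fst /snd !nrm_single.
  by do 4! move: (nrm _) => ?; lra.
apply: l2Z_sqr_nrm_eq0 => m; rewrite !big_cons big_nil /fst /snd.
rewrite l2Z_addE !singleE; case: eqP => [->|_].
  by rewrite [u n + _]addrC subrK; ring.
by rewrite addr0 nrm0; ring.
Qed.

(** For disjoint supports [nrm (u + t w) ^+ 2] has no term linear in [t], so the first variation
    kills [Re (f w)]; [- 'i *: w] handles the imaginary part. *)
Lemma support_disjoint u w (f : dual (l2Z X)) : support_functional u f ->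
  (forall n, u n = 0 \/ w n = 0) -> f w = 0.
Proof.
move=> /support_subgrad fu.
have Re0 v : (forall n, u n = 0 \/ v n = 0) -> complex.Re (f v) = 0.
  move=> uv; apply: (@linear_term_eq0 _ _ (nrm v ^+ 2)) => t.
  have := fu (u + t%:C *: v); rewrite addrAC subrr add0r.
  have -> : f (t%:C *: v) = t%:C * f v by rewrite linearZ.
  rewrite Re_scale.
  suff : \sum_(p <- [:: (1, u + t%:C *: v); (-1, u); (- t ^+ 2, v)])
      p.1 * nrm p.2 ^+ 2 = 0.
    by rewrite !big_cons big_nil /fst /snd; do 3! move: (nrm _) => ?; lra.
  apply: l2Z_sqr_nrm_eq0 => m; rewrite !big_cons big_nil /fst /snd.
  rewrite l2Z_addE l2Z_scaleE; have [->|->] := uv m.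
    by rewrite add0r sqr_nrmZr nrm0; ring.
  by rewrite scaler0 addr0 nrm0; ring.
move=> uw; have := Re0 _ uw; have : complex.Re (f (- 'i *: w)) = 0.
  apply: Re0 => n; rewrite l2Z_scaleE.
  by have [->|->] := uw n; [left|right; rewrite scaler0].
have -> : f (- 'i *: w) = - 'i * f w by rewrite linearZ.
by rewrite Re_mulNi; case: (f w) => a b /= -> ->.
Qed.

Lemma single_pairE i j x y n : i != j ->
  (single i x + single j y) n = if n == i then x else if n == j then y else 0.
Proof.
move=> ij; rewrite l2Z_addE !singleE; case: eqP => [->|_]; last by rewrite add0r.
by rewrite (negPf ij) addr0.
Qed.

(** The subgradient inequalities of [duality_map x] at coordinate [i] and [duality_map y] at [j] add
    up; every other coordinate of [v] only increases [nrm v]. *)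
Lemma support_pair_exists i j x y : i != j -> smooth_space X ->
  exists f : dual (l2Z X), support_functional (single i x + single j y) f.
Proof.
move=> ij smX; pose u := single i x + single j y.
pose g v := (duality_map x (v i) + duality_map y (v j) : R[i]^o).
have lg : linear (g : l2Z X -> R[i]^o).
  move=> a v w; rewrite /g !l2Z_addE !l2Z_scaleE !linearP scalerDr.
  by rewrite addrACA.
have gu : subgrad u g.
  move=> v; rewrite /g !l2Z_subE {1 2}/u !single_pairE// !eqxx eq_sym (negPf ij).
  have /support_subgrad/(_ (v i)) := duality_mapP x smX.
  have /support_subgrad/(_ (v j)) := duality_mapP y smX.
  rewrite Re_add.
  suff : \sum_(p <- [:: (1, u); (-1, v); (1, single i (v i));
      (1, single j (v j)); (-1, single i x); (-1, single j y)])
      p.1 * nrm p.2 ^+ 2 <= 0.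
    rewrite !big_cons big_nil /fst /snd !nrm_single.
    by do 4! move: (nrm _) => ?; lra.
  apply: l2Z_sqr_nrm_le0 => m; rewrite !big_cons big_nil /fst /snd.
  rewrite /u single_pairE// !singleE.
  have [->|mi] := eqVneq m i; first by rewrite (negPf ij) nrm0; nra.
  have [->|mj] := eqVneq m j; first by rewrite nrm0; nra.
  by rewrite nrm0; have := sqr_ge0 (nrm (v m)); nra.
by have [f fu _] := support_of_subgrad lg gu; exists f.
Qed.

Lemma support_coordinateE u (f : dual (l2Z X)) n y : smooth_space X ->
  support_functional u f -> f (single n y) = duality_map (u n) y.
Proof.
move=> smX fu; have lf : linear ((fun x => f (single n x)) : X -> R[i]^o).
  by move=> a x z; rewrite single_linear linearP.
have [g gu gE] := support_of_subgrad lf (support_coordinate n fu).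
by rewrite -gE (smooth_support_inj smX gu (duality_mapP _ smX)).
Qed.

(** A vector [v] splits into its coordinates [i] and [j], where smoothness of [X] fixes the values,
    and a rest disjoint from the pair, where both functionals vanish. *)
Lemma support_pair_inj i j x y (f g : dual (l2Z X)) : i != j -> smooth_space X ->
  support_functional (single i x + single j y) f ->
  support_functional (single i x + single j y) g -> f = g.
Proof.
move=> ij smX fu gu; apply: bounded_op_ext => v.
pose w := v - (single i (v i) + single j (v j)).
have uw n : (single i x + single j y) n = 0 \/ w n = 0.
  rewrite l2Z_subE !single_pairE//.
  case: eqP => [->|_]; first by right; rewrite subrr.
  by case: eqP => [->|_]; [right; rewrite subrr|left].
have dec (h : dual (l2Z X)) :
    h v = h w + (h (single i (v i)) + h (single j (v j))).
  by rewrite -!linearD subrK.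
rewrite !dec (support_disjoint fu uw) (support_disjoint gu uw).
by rewrite !(support_coordinateE _ _ smX fu) !(support_coordinateE _ _ smX gu).
Qed.

(** The functional [f] determines each [duality_map (u n)], which determines [u n] by strict
    convexity of [X]. *)
Lemma l2Z_support_inj u v (f : dual (l2Z X)) :
  smooth_space X -> strictly_convex_space X ->
  support_functional u f -> support_functional v f -> u = v.
Proof.
move=> smX scX fu fv; apply: l2Z_ext => n.
apply: (strictly_convex_support_inj scX (duality_mapP (u n) smX)).
have -> : duality_map (u n) = duality_map (v n).
  apply: bounded_op_ext => y.
  by rewrite -(support_coordinateE _ _ smX fu) (support_coordinateE _ _ smX fv).
exact: duality_mapP.
Qed.

End l2Z_facts.

(** * The four implications *)

Section equivalences.
Context {R : realType} {X : completeNormedModType R[i]}.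
Hypothesis X_smooth : smooth_space X.
Hypothesis X_strictly_convex : strictly_convex_space X.

Lemma hilbert_adjoint_linear : is_hilbert X ->
  forall T : bounded_op X X, rank_one T -> linear (adjoint T).
Proof.
move=> /is_hilbertP[B Bin] T [v _ rangeT].
apply: (inner_adjoint_rank_one Bin (v := v)) => y.
have : range T (T y) by exists y.
by rewrite rangeT => -[c _ <-]; exists c.
Qed.

Lemma adjoint_linear_hilbert :
  (forall T : bounded_op X X, rank_one T -> linear (adjoint T)) -> is_hilbert X.
Proof.
move=> adjl; apply: duality_map_additive_hilbert => // x y v.
(* For [v = 0] the operator [T] below would not have rank one. *)
have [->|v0] := eqVneq v 0; first by rewrite !linear0 addr0.
pose J := duality_map v.
have lT : linear (fun z => (J z : R[i]) *: v).
  by move=> a z w; rewrite linearP scalerDl scalerA.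
have bT : (fun z => (J z : R[i]) *: v) \in @bounded_op_pred R X X.
  apply: (@bounded_op_of_le _ _ _ _ (nrm v * nrm v)) => // z.
  rewrite nrmZ mulrAC ler_wpM2r ?nrm_ge0//.
  have /support_subgrad Jv := duality_mapP v X_smooth.
  exact: subgrad_norm_le.
pose T := BoundedOp bT.
have Jv0 : J v != 0.
  have [_ ->] := duality_mapP v X_smooth.
  by rewrite expf_neq0// normr_eq0.
have T1 : rank_one T.
  exists v => //; apply/seteqP; split=> [_ [z _ <-]|_ [c _ <-]].
    by exists (J z : R[i]).
  (* The range is the whole line because [J v], the value of the functional at its own point, is
     nonzero. *)
  exists ((c / J v) *: v) => //=.
  have -> : J ((c / J v) *: v) = c / J v * J v by rewrite linearZ.
  by rewrite divfK.
have adjE z : adjoint T z = conjc (duality_map z v) *: v.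
  have e : banach_adjoint T (duality_map z) =
      duality_map (conjc (duality_map z v) *: v).
    apply: bounded_op_ext => w; rewrite duality_map_scale// conjcK /=.
    have -> : duality_map z ((J w : R[i]) *: v) = J w * duality_map z v.
      by rewrite linearZ.
    by rewrite mulrC.
  rewrite /adjoint e.
  have : exists w : X, duality_map w = duality_map (conjc (duality_map z v) *: v).
    by exists (conjc (duality_map z v) *: v).
  move=> /(xgetPex 0) /= h.
  (* [duality_map_inv] picks some preimage; strict convexity makes it the expected one. *)
  apply: (strictly_convex_support_inj X_strictly_convex (duality_mapP _ X_smooth)).
  by rewrite h; exact: duality_mapP.
have := adjl T T1 1 x y; rewrite !scale1r !adjE -scalerDl => /eqP.
rewrite -subr_eq0 -scalerBl scaler_eq0 (negPf v0) orbF subr_eq0 -rmorphD.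
by move=> /eqP/(can_inj (@conjcK R)).
Qed.

Lemma hilbert_adjoint_shift : is_hilbert X ->
  adjoint (id_op (l2Z X) + bilateral_shift X) =
    (fun u : l2Z X => u + adjoint (bilateral_shift X) u).
Proof.
move=> /hilbert_real_quadratic/l2Z_real_quadratic/real_quadratic_hilbert.
move=> /is_hilbertP[B Bin]; apply/funext => u.
have [f fu fB] := inner_support_exists Bin u.
have shiftE v : B (bilateral_shift X v) u = B v (unshift u).
  by rewrite -fB -(iffLR (inner_supportP Bin _ _) (support_unshift fu)).
have -> : adjoint (bilateral_shift X) u = unshift u by exact: (inner_adjointE Bin).
apply: (inner_adjointE Bin) => v.
have -> : (id_op (l2Z X) + bilateral_shift X) v = v + bilateral_shift X v by [].
by rewrite (inner_Dl Bin) (inner_Dr Bin) shiftE.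
Qed.

Lemma adjoint_shift_hilbert :
  adjoint (id_op (l2Z X) + bilateral_shift X) =
    (fun u : l2Z X => u + adjoint (bilateral_shift X) u) -> is_hilbert X.
Proof.
move=> adjE; apply: duality_map_additive_hilbert => // x y z.
have J0 : duality_map (0 : X) = 0 by apply/support0/duality_mapP.
(* With [x != 0], the vectors and functionals below are nonzero, which separates them from the
   default values of [duality_map] and [duality_map_inv]. *)
have [->|x0] := eqVneq x 0; first by rewrite J0 !add0r.
pose u : l2Z X := single 0 x + single 1 y; pose F := duality_map u.
have Fu : support_functional u F.
  have [f fu] := @support_pair_exists _ _ 0 1 x y isT X_smooth.
  exact: duality_map_support fu.
have u'E : unshift u = single (-1) x + single 0 y.
  apply: l2Z_ext => n; rewrite !single_pairE// -[LHS]/(u (n + 1)) single_pairE//.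
  by rewrite addr_eq0 -[n == 0](inj_eq (addIr 1)) add0r.
have at_m1 v : (single (-1) x + v : l2Z X) (-1) = x + v (-1).
  by rewrite l2Z_addE singleE eqxx.
have adjU : adjoint (bilateral_shift X) u = unshift u.
  apply: (duality_map_invE _ _ (support_unshift Fu)).
  - by move=> v; apply: l2Z_support_inj => //; exact: support_unshift.
  - rewrite u'E; apply: contra_neq x0 => /(congr1 (fun w : l2Z X => w (-1))).
    by rewrite at_m1 singleE addr0.
  - move=> g; have := support_unshift Fu; rewrite u'E => h gu.
    exact: (support_pair_inj _ X_smooth gu h).
pose G := banach_adjoint (id_op (l2Z X) + bilateral_shift X) F.
have GE n w : G (single n w) = F (single n w) + F (single (n + 1) w).
  by rewrite -shift_single -linearD.
have FE n w : F (single n w) = duality_map (u n) w by exact: support_coordinateE.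
have uE n : u n = if n == 0 then x else if n == 1 then y else 0.
  exact: single_pairE.
(* The entries of [s] at -1, 0, 1 are [x], [x + y], [y]: coordinate 0 carries the sum, and
   coordinate -1 shows [s != 0]. *)
pose s := u + unshift u.
have sG : duality_map_inv G = s by have := congr1 (@^~ u) adjE; rewrite /= adjU.
have s_m1 : s (-1) = x by rewrite l2Z_addE -[unshift u _]/(u (-1 + 1)) !uE add0r.
have s_0 : s 0 = x + y by rewrite l2Z_addE -[unshift u _]/(u (0 + 1)) !uE.
have s0 : s != 0.
  by apply: contra_neq x0 => /(congr1 (fun w : l2Z X => w (-1))); rewrite s_m1.
have Js : duality_map s = G by rewrite -sG duality_map_inv_neq0// sG.
(* At [single (-1) x] the first summand of [G] is [duality_map 0 x = 0] and the second is
   [duality_map x x], which is nonzero. *)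
have G0 : G != 0.
  apply: contra_neq x0 => /(congr1 (fun g : dual (l2Z X) => g (single (-1) x))).
  rewrite GE !FE !uE /= J0 [X in X + _ = _](_ : _ = 0)// add0r.
  have [_ ->] := duality_mapP x X_smooth => /eqP.
  by rewrite expf_eq0 /= normr_eq0 => /eqP.
have Gs : support_functional s G by rewrite -Js; apply: duality_map_neq0; rewrite Js.
(* At coordinate 0, [G] is [duality_map (x + y)] as a support functional of [s], and
   [duality_map x + duality_map y] by [GE]. *)
by rewrite -s_0 -(support_coordinateE 0 z X_smooth Gs) GE !FE !uE.
Qed.

End equivalences.

Theorem theorem7p29 (R : realType) (X : completeNormedModType R[i])
    (X_reflexive : reflexive_space X) (X_smooth : smooth_space X)
    (X_strictly_convex : strictly_convex_space X) (X_dim : dim_gt2 X) :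
  (is_hilbert X <->
     forall T : bounded_op X X, rank_one T -> linear (adjoint T)) /\
  (is_hilbert X <->
     adjoint (id_op (l2Z X) + bilateral_shift X) =
       (fun u : l2Z X => u + adjoint (bilateral_shift X) u)).
Proof.
split; split.
- exact: hilbert_adjoint_linear.
- exact: adjoint_linear_hilbert.
- exact: hilbert_adjoint_shift.
- exact: adjoint_shift_hilbert.
Qed.
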